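(* Let $F$ be a free group of finite rank $n \geq 2$. Then the set of test elements of $F$ is a $(3n-2)$-net with respect to every finite generating set of $F$.
   Context: An element $g$ of a group $G$ is a test element of $G$ if every endomorphism $\varphi$ of $G$ with $\varphi(g)=g$ is an automorphism of $G$. For a finitely generated group $G$ with finite generating set $X$ and $g\in G$, $|g|_X$ denotes the smallest integer $k\ge 0$ for which there exist $x_1,\dots,x_k\in X^{\pm1}$ with $g=x_1\cdots x_k$. The word metric is $d_X(g,h)=|g^{-1}h|_X$. A subset $S\subseteq G$ is a $C$-net ($0\le C<\infty$) with respect to $X$ if $d_X(g,S)=\inf\{d_X(g,s)\mid s\in S\}\le C$ for all $g\in G$. *)

(* Defs.v *)
From mathcomp Require Import all_boot all_order all_algebra.
From mathcomp Require Import all_classical all_reals ereal.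

Set Implicit Arguments.
Unset Strict Implicit.
Unset Printing Implicit Defensive.

Import Order.TTheory GRing.Theory Num.Theory.

Local Open Scope classical_set_scope.
Local Open Scope group_scope.

(* Groups are [groupType]s, possibly infinite; a [{multiplicative G -> H}]
   between groups preserves products, hence is a group homomorphism. *)

Definition is_free_basis (n : nat) (F : groupType) (b : 'I_n -> F) : Prop :=
  forall (H : groupType) (f : 'I_n -> H),
    exists2 phi : {multiplicative F -> H},
      forall i, phi (b i) = f i &
      forall psi : {multiplicative F -> H},
        (forall i, psi (b i) = f i) -> psi =1 phi.

Definition free_of_rank (F : groupType) (n : nat) : Prop :=
  exists b : 'I_n -> F, is_free_basis b.

Definition test_elements (G : groupType) : set G :=
  [set g | forall phi : {multiplicative G -> G}, phi g = g -> bijective phi].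
Arguments test_elements : clear implicits.

(* The lengths k of the words x_1 ... x_k in the letters X^{+-1} spelling g. *)
Definition spelling_lengths (G : groupType) (X : set G) (g : G) : set nat :=
  [set k | exists w : seq G,
     [/\ size w = k,
         forall x, x \in w -> (X `|` [set y^-1 | y in X]) x &
         g = \prod_(x <- w) x]].

Definition generates (G : groupType) (X : set G) : Prop :=
  forall g : G, spelling_lengths X g !=set0.

(* The minimum is 0 by convention if no word spells g; this does not occur when
   X generates G. *)
Definition word_length (G : groupType) (X : set G) (g : G) : nat :=
  xget 0%N [set k | spelling_lengths X g k /\
                    forall j, spelling_lengths X g j -> (k <= j)%N].

Definition word_dist (G : groupType) (X : set G) (g h : G) : nat :=
  word_length X (g^-1 * h).

(* The infimum is taken in the extended reals: the distance to the empty set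
   is +oo. *)
Definition dist_to_set (R : realType) (G : groupType) (X : set G)
    (g : G) (S : set G) : \bar R :=
  ereal_inf [set ((word_dist X g s)%:R%:E)%E | s in S].

Definition is_net (R : realType) (G : groupType) (X : set G) (C : R)
    (S : set G) : Prop :=
  (0 <= C)%R /\ forall g : G, (dist_to_set R X g S <= C%:E)%E.

(* Main.v *)
Require Import Defs.
From HB Require Import structures.
From mathcomp Require Import all_boot all_order all_algebra fingroup.
From mathcomp Require Import all_classical all_reals ereal.

(** An endomorphism phi fixing a word w preserves every invariant of w, and some
    invariants are rigid enough to force phi to be an automorphism.

    The invariant. Expand the words of F in noncommuting variables X_i by
    b_i -> 1 + X_i, with coefficients modulo 2 and up to degree 2. If w has no
    linear part and its quadratic part is an invertible matrix B, then
    phi w = w gives B = A^T B A, where A is the matrix of phi on the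
    abelianization ([fixing_abelianized_unit]). So A is invertible modulo 2,
    and the integral matrix of phi has an odd, hence nonzero, determinant.

    Injectivity ([injective_of_det]). An endomorphism whose integral matrix has
    nonzero determinant is injective. A nontrivial word is detected by a
    homomorphism theta into unitriangular matrices over F_p, for every prime p
    outside a finite set. Composition with phi is injective on the finite set of
    such homomorphisms as soon as p does not divide the determinant, hence
    surjective on it. So theta = theta' o phi for some theta', and phi does not
    kill the word.

    Surjectivity ([nonsingular_test]). Let H be the image of an iterate of phi.
    The word w traces a path in the Schreier graph of H, and H retracts onto the
    subgroup K carried by that path ([retraction_exists]). Transported to F by
    the iterate, the retraction is an idempotent endomorphism fixing w; it is
    injective, hence the identity, and H = K. As K is determined by the pairs of
    vertices of the path which get identified, the images of the iterates of phi
    form a descending chain in a finite set. Hence two of them coincide and phi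
    is onto.

    The net ([nonsingular_nearby]). The generating set contains x_1, ..., x_n
    forming a basis of the abelianization modulo 2. Given g, multiply it by
    powers of x_1, ..., x_n: the parity of each exponent is prescribed by the
    linear part of g, and either choice of the exponent, in {0, 2} or in
    {1, -1}, costs at most two letters. The two choices differ by x_i^2, whose
    expansion 1 + (linear part of x_i)^2 is central modulo degree 3. Hence the
    choices add an arbitrary 0-1 diagonal matrix, in the basis of the x_i, to
    the quadratic part. Some diagonal matrix makes it invertible
    ([diagonal_correction]). The total cost is at most 2 n, which does not
    exceed 3 n - 2 because n >= 2. *)

Set Implicit Arguments.
Unset Strict Implicit.
Unset Printing Implicit Defensive.

Import Order.TTheory GRing.Theory Num.Theory.

Local Open Scope classical_set_scope.
Local Open Scope group_scope.

(** * Free groups and their homomorphisms *)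

Section Homomorphisms.

Variables (G H : groupType) (f : {multiplicative G -> H}).

Lemma hom1 : f 1 = 1.
Proof. by apply: (mulgI (f 1)); rewrite -gmulfM !mulg1. Qed.

Lemma homV : {morph f : x / x^-1}.
Proof. by move=> x; apply/esym/mulg1_eq; rewrite -gmulfM mulgV hom1. Qed.

Lemma hom_inj : (forall x, f x = 1 -> x = 1) -> injective f.
Proof.
by move=> fI x y fxy; apply/divg1_eq/fI; rewrite gmulfM homV fxy mulgV.
Qed.

End Homomorphisms.

Section Subgroups.

Variable G : groupType.

Definition is_subgroup (P : set G) : Prop :=
  [/\ P 1, forall x y, P x -> P y -> P (x * y) & forall x, P x -> P x^-1].

Variables (P : set G) (sgP : is_subgroup P).

(** The closure proof is a parameter of the type, so that the group structure
    can be inferred from the type alone. *)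
Record subgroup_type (sg : is_subgroup P) :=
  SubgroupType { subgroup_incl : G; _ : subgroup_incl \in P }.

HB.instance Definition _ := [isSub for @subgroup_incl sgP].
HB.instance Definition _ := [Choice of subgroup_type sgP by <:].

Fact subgroup_closed : group_closed [pred x | x \in P].
Proof.
have [P1 PM PV] := sgP; split; first exact: mem_set.
by move=> x y /set_mem Px /set_mem Py; apply/mem_set/PM => //; apply: PV.
Qed.

HB.instance Definition _ :=
  SubChoice_isSubGroup.Build G _ (subgroup_type sgP) subgroup_closed.

End Subgroups.

Section FreeBasis.

Variables (n : nat) (F : groupType) (b : 'I_n -> F).
Hypothesis freeb : is_free_basis b.

Lemma free_hom_ext (H : groupType) (f g : {multiplicative F -> H}) :
  (forall i, f (b i) = g (b i)) -> f =1 g.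
Proof.
move=> fg x; have [h _ hU] := freeb (fun i => f (b i)).
by rewrite (hU f)// (hU g).
Qed.

(** The basis lifts to a homomorphism from [F] to the subgroup [P]; followed by
    the inclusion, it fixes the basis, so it is the identity. *)
Lemma free_basis_ind (P : set F) :
  is_subgroup P -> (forall i, P (b i)) -> forall x, P x.
Proof.
move=> sgP Pb x.
pose c i : subgroup_type sgP := SubgroupType sgP (mem_set (Pb i)).
have [phi phib _] := freeb c.
pose incl : {multiplicative subgroup_type sgP -> F} := val.
have <- : (incl \o phi) x = x.
  by apply: (@free_hom_ext _ (incl \o phi) idfun) => i; rewrite /= phib.
exact/set_mem/(valP (phi x)).
Qed.

End FreeBasis.

(** * Expansions of degree two *)

Section MagnusGroup.

Variables (k : comNzRingType) (n : nat).

(** The pair [(a, M)] stands for the series 1 + (sum of a_i X_i) +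
    (sum of M_ij X_i X_j) in noncommuting variables, modulo degree 3. *)
Definition magnus2 := ('rV[k]_n * 'M[k]_n)%type.

HB.instance Definition _ := Choice.on magnus2.

Implicit Types u v : magnus2.

Local Open Scope ring_scope.

Definition magnus2_one : magnus2 := (0, 0).
Definition magnus2_mul u v : magnus2 := (u.1 + v.1, u.2 + v.2 + u.1^T *m v.1).
Definition magnus2_inv u : magnus2 := (- u.1, - u.2 + u.1^T *m u.1).

Fact magnus2_mulA : associative magnus2_mul.
Proof.
move=> u v w; congr (_, _) => /=; first exact: addrA.
rewrite [(_ + _)^T]raddfD/= mulmxDl mulmxDr !addrA.
by rewrite [RHS](ACl (1*2*4*6*3*5)).
Qed.

Fact magnus2_mul1 : left_id magnus2_one magnus2_mul.
Proof.
by case=> a M; congr (_, _); rewrite /= ?trmx0 ?mul0mx ?add0r ?addr0.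
Qed.

Fact magnus2_1mul : right_id magnus2_one magnus2_mul.
Proof. by case=> a M; congr (_, _); rewrite /= ?mulmx0 ?addr0. Qed.

Fact magnus2_mulV : left_inverse magnus2_one magnus2_inv magnus2_mul.
Proof.
case=> a M; congr (_, _) => /=; first by rewrite addNr.
by rewrite linearN/= mulNmx addrAC addrK addNr.
Qed.

Fact magnus2_Vmul : right_inverse magnus2_one magnus2_inv magnus2_mul.
Proof.
case=> a M; congr (_, _) => /=; first by rewrite subrr.
by rewrite mulmxN addrA subrr add0r subrr.
Qed.

HB.instance Definition _ := isGroup.Build magnus2
  magnus2_mulA magnus2_mul1 magnus2_1mul magnus2_mulV magnus2_Vmul.

Variables (G : groupType) (mu : {multiplicative G -> magnus2}).

Lemma magnusM1 x y : (mu (x * y)%g).1 = (mu x).1 + (mu y).1.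
Proof. by rewrite gmulfM. Qed.

Lemma magnusM2 x y :
  (mu (x * y)%g).2 = (mu x).2 + (mu y).2 + (mu x).1^T *m (mu y).1.
Proof. by rewrite gmulfM. Qed.

Lemma magnusV1 x : (mu x^-1%g).1 = - (mu x).1.
Proof. by rewrite homV. Qed.

Lemma magnusV2 x : (mu x^-1%g).2 = - (mu x).2 + (mu x).1^T *m (mu x).1.
Proof. by rewrite homV. Qed.

End MagnusGroup.

Section MagnusExpansion.

Variables (n : nat) (F : groupType) (b : 'I_n -> F).
Hypothesis freeb : is_free_basis b.

Definition is_magnus (k : comNzRingType) (mu : F -> magnus2 k n) : Prop :=
  forall i, mu (b i) = (delta_mx 0 i, 0)%R.

Lemma magnus_exists (k : comNzRingType) :
  exists mu : {multiplicative F -> magnus2 k n}, is_magnus mu.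
Proof.
have [mu mub _] := freeb (fun i => (delta_mx 0 i, 0)%R : magnus2 k n).
by exists mu.
Qed.

Local Open Scope ring_scope.

(** With integer coefficients, the linear part of the expansion of a word lists
    the exponent sums of its letters. *)
Lemma additive_exponent_sum (mu : {multiplicative F -> magnus2 int n})
    (V : zmodType) (d : F -> V) :
    is_magnus mu -> (forall x y, d (x * y)%g = d x + d y) ->
  forall x, d x = \sum_j d (b j) *~ (mu x).1 0 j.
Proof.
move=> mub dM.
have d1 : d 1%g = 0 by apply: (addrI (d 1%g)); rewrite -dM mulg1 addr0.
apply: (free_basis_ind freeb).
  split=> [|x y dx dy|x dx].
  - by rewrite hom1 d1 big1// => j _; rewrite mxE mulr0z.
  - rewrite dM dx dy -big_split; apply: eq_bigr => j _ /=.
    by rewrite magnusM1 mxE mulrzDr.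
  - apply: (addrI (d x)); rewrite -dM mulgV d1 dx -big_split big1// => j _.
    by rewrite /= magnusV1 mxE mulrNz subrr.
move=> i; rewrite mub (bigD1 i)//= mxE !eqxx mulr1z big1 ?addr0// => j jNi.
by rewrite mxE eqxx (negPf jNi) mulr0z.
Qed.

Definition abelianized (k : comNzRingType) (mu : F -> magnus2 k n)
  (phi : F -> F) : 'M[k]_n := \matrix_i (mu (phi (b i))).1.

(** An endomorphism acts on truncated expansions by the substitution which
    replaces X_j by the expansion of [phi (b j)] minus 1, whose linear part is
    given by the j-th row of [A]. *)
Lemma magnus_endo (k : comNzRingType) (mu : {multiplicative F -> magnus2 k n})
    (phi : {multiplicative F -> F}) (A := abelianized mu phi) :
    is_magnus mu ->
  forall x, (mu (phi x)).1 = (mu x).1 *m A /\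
    (mu (phi x)).2 = A^T *m (mu x).2 *m A
                     + \sum_j (mu x).1 0 j *: (mu (phi (b j))).2.
Proof.
move=> mub; apply: (free_basis_ind freeb).
  split=> [|x y [x1 x2] [y1 y2]|x [x1 x2]].
  - rewrite !hom1 mul0mx mulmx0 mul0mx add0r big1// => j _.
    by rewrite mxE scale0r.
  - rewrite gmulfM !magnusM1 !magnusM2 x1 x2 y1 y2 mulmxDl; split=> //.
    rewrite !mulmxDr !mulmxDl trmx_mul !mulmxA.
    have -> : \sum_j ((mu x).1 + (mu y).1) 0 j *: (mu (phi (b j))).2 =
        \sum_j (mu x).1 0 j *: (mu (phi (b j))).2
        + \sum_j (mu y).1 0 j *: (mu (phi (b j))).2.
      by rewrite -big_split; apply: eq_bigr => j _; rewrite mxE scalerDl.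
    by rewrite !addrA [RHS](ACl (1*4*2*5*3)).
  - rewrite homV !magnusV1 !magnusV2 x1 x2 mulNmx; split=> //.
    rewrite !mulmxDr !mulmxDl trmx_mul !mulmxA mulmxN mulNmx.
    have -> : \sum_j (- (mu x).1) 0 j *: (mu (phi (b j))).2 =
        - \sum_j (mu x).1 0 j *: (mu (phi (b j))).2.
      by rewrite -sumrN; apply: eq_bigr => j _; rewrite mxE scaleNr.
    by rewrite opprD addrAC.
move=> i; rewrite mub /= mulmx0 mul0mx add0r -rowE rowK; split=> //.
rewrite (bigD1 i)//= mxE !eqxx scale1r big1 ?addr0// => j jNi.
by rewrite mxE eqxx (negPf jNi) scale0r.
Qed.

(** When the linear part of [w] vanishes, its quadratic part [B] is transformed
    by [A] alone, and [phi w = w] reads B = A^T B A. *)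
Lemma fixing_abelianized_unit (k : comUnitRingType)
    (mu : {multiplicative F -> magnus2 k n}) (phi : {multiplicative F -> F})
    (w : F) : is_magnus mu -> (mu w).1 = 0 -> (mu w).2 \in unitmx ->
  phi w = w -> abelianized mu phi \in unitmx.
Proof.
move=> mub w1 w2 phiw; have [_] := magnus_endo phi mub w.
rewrite phiw big1 ?addr0; last by move=> j _; rewrite w1 mxE scale0r.
by move=> Bw; move: w2; rewrite [X in X \in _]Bw unitmx_mul => /andP[].
Qed.

(** The coefficients modulo 2 are what makes this condition reachable by a
    bounded correction: the linear part can be cancelled by multiplying by
    letters, and squares of letters adjust the quadratic part. *)
Definition nonsingular (w : F) : Prop :=
  exists2 mu : {multiplicative F -> magnus2 'F_2 n}, is_magnus mu &
    (mu w).1 = 0 /\ (mu w).2 \in unitmx.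

(** The determinant is odd, since it is nonzero modulo 2. *)
Lemma fixing_abelianized_det (mu : {multiplicative F -> magnus2 int n})
    (phi : {multiplicative F -> F}) (w : F) :
    is_magnus mu -> nonsingular w -> phi w = w ->
  \det (abelianized mu phi) != 0.
Proof.
move=> mub [nu nub [w1 w2]] phiw.
have := fixing_abelianized_unit nub w1 w2 phiw.
suff -> : abelianized nu phi = map_mx intr (abelianized mu phi).
  rewrite unitmxE det_map_mx unitfE; apply: contraNneq => ->.
  by rewrite /= mulr0z.
apply/matrixP => i j; rewrite !mxE.
pose d x := (nu x).1 0 j.
have dM x y : d (x * y)%g = d x + d y by rewrite /d magnusM1 mxE.
rewrite -/(d (phi (b i))) (additive_exponent_sum mub dM) (bigD1 j)//= big1.
  by rewrite /d nub mxE !eqxx addr0.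
by move=> l lNj; rewrite /d nub mxE eq_sym (negPf lNj) andbF mul0rz.
Qed.

End MagnusExpansion.

(** * Reduced words *)

Section SyllableForm.

Definition expz (G : groupType) (x : G) (z : int) : G :=
  match z with Posz k => x ^+ k | Negz k => x ^- k.+1 end.

Lemma expz_succ (G : groupType) (x : G) z : expz x (1 + z)%R = x * expz x z.
Proof.
case: z => [k|[|k]]; first by rewrite -PoszD add1n /= expgS.
  by rewrite NegzE subrr /= mulgV.
rewrite [in LHS]NegzE -addn1 PoszD opprD addrCA subrr addr0 -NegzE /=.
by rewrite [in RHS]expgSr invgM mulgA mulgV mul1g.
Qed.

Lemma expz_pred (G : groupType) (x : G) z : expz x (z - 1)%R = x^-1 * expz x z.
Proof.
by apply: (mulgI x); rewrite mulVKg -expz_succ addrC subrK.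
Qed.

Definition syllable_prod n (G : groupType) (b : 'I_n -> G)
  (s : seq ('I_n * int)) : G := \prod_(y <- s) expz (b y.1) y.2.

Definition reduced n (s : seq ('I_n * int)) : bool :=
  sorted (fun y z => y.1 != z.1) s && all (fun y => y.2 != 0%R) s.

Variables (n : nat) (F : groupType) (b : 'I_n -> F).
Hypothesis freeb : is_free_basis b.

Lemma reduced_mul_letter (i : 'I_n) (e : int) s : e = 1%R \/ e = (- 1)%R ->
  reduced s -> exists2 t, reduced t &
    syllable_prod b t = expz (b i) e * syllable_prod b s.
Proof.
move=> e1; have e0 : e != 0%R by case: e1 => ->.
have expzM z : expz (b i) (e + z)%R = expz (b i) e * expz (b i) z.
  case: e1 => ->; first by rewrite expz_succ.
  by rewrite addrC expz_pred.
case: s => [|[j f] s].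
  exists [:: (i, e)]; first by rewrite /reduced /= e0.
  by rewrite /syllable_prod big_seq1 big_nil mulg1.
rewrite /reduced /= => /andP[ps /andP[f0 s0]].
have [ij|ij] := eqVneq i j; last first.
  exists ((i, e) :: (j, f) :: s); first by rewrite /= ij ps e0 f0.
  by rewrite /syllable_prod big_cons.
rewrite -{j}ij in ps *; rewrite /syllable_prod big_cons mulgA -expzM /=.
have [ef0|ef0] := eqVneq (e + f)%R 0%R.
  exists s; first by rewrite s0 andbT; case: (s) ps => //= y s' /andP[].
  by rewrite ef0 mul1g.
exists ((i, (e + f)%R) :: s); last by rewrite big_cons.
by rewrite /= ef0 s0 !andbT; case: (s) ps.
Qed.

(** Elements whose translations preserve the set of reduced products in both
    directions form a subgroup, so only the letters need to be examined. *)
Lemma reduced_form (g : F) : exists2 s, reduced s & syllable_prod b s = g.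
Proof.
pose P h := exists2 s, reduced s & syllable_prod b s = h.
suff Pg x : forall h, P h <-> P (x * h).
  rewrite -/(P g) -[g]mulg1; apply: (iffLR (Pg g 1)); exists [::] => //.
  by rewrite /syllable_prod big_nil.
apply: (free_basis_ind (P := fun x => forall h, P h <-> P (x * h)) freeb).
  split=> [h|y z Py Pz h|y Py h]; first by rewrite mul1g.
  - by rewrite -mulgA -Py.
  - by rewrite [in X in _ <-> X]Py mulVKg.
move=> i h; split=> [[s rs <-]|[s rs sh]].
  have [|t rt tE] := @reduced_mul_letter i 1%R s _ rs; first by left.
  by exists t.
have [|t rt tE] := @reduced_mul_letter i (- 1)%R s _ rs; first by right.
by exists t; rewrite // tE sh /= mulKg.
Qed.

End SyllableForm.

(** * Unitriangular homomorphisms *)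

Section Levels.

Variables (K : nzRingType) (m : nat).
Local Open Scope ring_scope.

(** The [t]-th power of the ideal of strictly upper triangular matrices
    consists of matrices vanishing below the [t]-th superdiagonal. *)
Definition above_diag (t : nat) (M : 'M[K]_m) : bool :=
  [forall r : 'I_m, forall c : 'I_m, (c < r + t)%N ==> (M r c == 0)].

Lemma above_diagP t (M : 'M[K]_m) :
  reflect (forall r c : 'I_m, (c < r + t)%N -> M r c = 0) (above_diag t M).
Proof.
apply: (iffP forallP) => [H r c rc|H r]; last first.
  by apply/forallP => c; apply/implyP => /H/eqP.
by apply/eqP; have /forallP/(_ c)/implyP := H r; apply.
Qed.

Lemma above_diagD t (M N : 'M[K]_m) :
  above_diag t M -> above_diag t N -> above_diag t (M + N).
Proof.
move=> /above_diagP tM /above_diagP tN; apply/above_diagP => r c rc.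
by rewrite mxE tM// tN// addr0.
Qed.

Lemma above_diagN t (M : 'M[K]_m) : above_diag t M -> above_diag t (- M).
Proof.
move=> /above_diagP tM; apply/above_diagP => r c rc.
by rewrite mxE tM// oppr0.
Qed.

Lemma above_diagM s t (M N : 'M[K]_m) :
  above_diag s M -> above_diag t N -> above_diag (s + t) (M *m N).
Proof.
move=> /above_diagP sM /above_diagP tN; apply/above_diagP => r c rc.
rewrite mxE big1// => l _; have [lr|rl] := ltnP l (r + s).
  by rewrite sM// mul0r.
by rewrite tN ?mulr0// (leq_trans rc)// addnA leq_add2r.
Qed.

Lemma above_diagW s t (M : 'M[K]_m) :
  (s <= t)%N -> above_diag t M -> above_diag s M.
Proof.
move=> st /above_diagP tM; apply/above_diagP => r c rc.
by rewrite tM// (leq_trans rc)// leq_add2l.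
Qed.

Lemma above_diag_eq0 (M : 'M[K]_m) : above_diag m M -> M = 0.
Proof.
move=> /above_diagP mM; apply/matrixP => r c.
by rewrite mM ?mxE// (leq_trans (ltn_ord c))// leq_addl.
Qed.

End Levels.

Section UnitriangularHomomorphisms.

Variables (n : nat) (F : groupType) (b : 'I_n -> F).
Hypothesis freeb : is_free_basis b.
Variable mu : {multiplicative F -> magnus2 int n}.
Hypothesis mub : is_magnus b mu.
Variable phi : {multiplicative F -> F}.
Variables (K : finFieldType) (m : nat).
Hypothesis det_phi : ((\det (abelianized b mu phi))%:~R != 0 :> K)%R.

Local Notation GL := {'GL_m.+1[K]}.
Implicit Types theta : {multiplicative F -> GL}.

Definition unitriangular (u : GL) : bool :=
  above_diag 1 (GLval u - 1)%R.

Lemma unitriangular_subgroup : is_subgroup [set u : GL | unitriangular u].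
Proof.
have U1 : unitriangular 1.
  by rewrite /unitriangular subrr; apply/above_diagP => r c _; rewrite mxE.
have UM u v : unitriangular u -> unitriangular v -> unitriangular (u * v).
  rewrite /unitriangular GL_ME => Uu Uv.
  have -> : (GLval u * GLval v - 1 = (GLval u - 1) * (GLval v - 1)
      + (GLval u - 1) + (GLval v - 1))%R.
    by rewrite mulrBl mul1r addrAC subrK mulrBr mulr1 addrA subrK.
  do 2?apply: above_diagD => //.
  by apply: (@above_diagW _ _ _ 2) => //; apply: (above_diagM Uu Uv).
split=> // u Uu /=; rewrite invg_expg.
by elim: (_.-1) => [|k IHk]; rewrite ?expg0 // expgS; apply: UM.
Qed.

Lemma unitriangular_hom theta :
  (forall i, unitriangular (theta (b i))) -> forall x, unitriangular (theta x).
Proof.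
move=> Ub; have [U1 UM UV] := unitriangular_subgroup.
apply: (free_basis_ind freeb (P := fun x => unitriangular (theta x))) => //.
split=> [|x y|x]; rewrite ?hom1 ?gmulfM ?homV//; [exact: UM | exact: UV].
Qed.

Local Open Scope ring_scope.

(** The elements [phi (b i)] span the abelianization over [K]. *)
Lemma additive_eq0 (d : F -> K) : (forall x y, d (x * y)%g = d x + d y) ->
  (forall i, d (phi (b i)) = 0) -> forall x, d x = 0.
Proof.
move=> dM dphi; pose A : 'M[K]_n := map_mx intr (abelianized b mu phi).
pose v := \col_j d (b j).
suff v0 : v = 0.
  move=> x; rewrite (additive_exponent_sum freeb mub dM) big1// => j _.
  by have /matrixP/(_ j 0) := v0; rewrite !mxE => ->; rewrite mul0rz.
have uA : A \in unitmx by rewrite unitmxE det_map_mx unitfE.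
rewrite -[v]mul1mx -(mulVmx uA) -mulmxA; suff -> : A *m v = 0 by rewrite mulmx0.
apply/matrixP => i j; rewrite !mxE -[RHS](dphi i).
rewrite [RHS](additive_exponent_sum freeb mub dM); apply: eq_bigr => l _.
by rewrite !mxE mulrzl.
Qed.

(** On the first superdiagonal where they could differ, the difference of two
    unitriangular homomorphisms is additive and vanishes on the image of [phi],
    hence vanishes. *)
Lemma unitriangular_hom_eq theta1 theta2 :
    (forall x, unitriangular (theta1 x)) ->
    (forall x, unitriangular (theta2 x)) ->
    (forall x, theta1 (phi x) = theta2 (phi x)) ->
  forall x, theta1 x = theta2 x.
Proof.
move=> U1 U2 th12 x.
pose D y : 'M[K]_(m.+1) := GLval (theta1 y) - GLval (theta2 y).
suff D0 t : forall y, above_diag t.+1 (D y).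
  by apply/val_inj/eqP; rewrite -subr_eq0; apply/eqP/above_diag_eq0/(D0 m).
elim: t => [|t IHt] y.
  rewrite /D -(subrKA 1 (GLval (theta1 y))) -[1 - _]opprB.
  by apply: above_diagD; [exact: U1 | apply: above_diagN; exact: U2].
apply/above_diagP => r c rc.
have [cr|cr] := ltnP c (r + t.+1); first by have /above_diagP -> := IHt y.
apply: (@additive_eq0 (fun z => D z r c)) => [z z'|i]; last first.
  by rewrite /D th12 subrr mxE.
have -> : D (z * z')%g = (GLval (theta1 z) - 1) * D z'
    + D z * (GLval (theta2 z') - 1) + (D z + D z').
  rewrite mulrBl mul1r [D z * _]mulrBr mulr1 [X in _ = X + _]addrACA -opprD.
  rewrite [D z' + _]addrC.
  by rewrite subrK /D !gmulfM !GL_ME mulrBr mulrBl addrA subrK.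
rewrite mxE [X in _ + X]mxE.
set E : 'M[K]_m.+1 := (X in fun_of_matrix X r c + _).
suff -> : E r c = 0 by rewrite add0r.
suff /above_diagP : above_diag t.+2 E by apply.
apply: above_diagD; first exact: (above_diagM (U1 z) (IHt z')).
by rewrite -[t.+2]addn1; exact: (above_diagM (IHt z) (U2 z')).
Qed.

(** There are finitely many unitriangular homomorphisms, and composition with
    [phi] is injective on them, hence surjective. *)
Lemma unitriangular_hom_lift theta : (forall x, unitriangular (theta x)) ->
  exists theta' : {multiplicative F -> GL}, forall x, theta x = theta' (phi x).
Proof.
move=> Uth.
have /choice[H HE] (f : {ffun 'I_n -> GL}) :
    exists h : {multiplicative F -> GL}, forall i, h (b i) = f i.
  by have [h hE _] := freeb f; exists h.
pose D := [set f : {ffun 'I_n -> GL} | [forall i, unitriangular (f i)]]%SET.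
have UD f : f \in D -> forall x, unitriangular (H f x).
  by rewrite inE => /forallP Df; apply: unitriangular_hom => i; rewrite HE.
pose G (f : {ffun 'I_n -> GL}) := [ffun i => H f (phi (b i))].
have Ginj : {in D &, injective G}.
  move=> f1 f2 D1 D2 G12; apply/ffunP => i; rewrite -!HE.
  apply: unitriangular_hom_eq; [exact: UD | exact: UD |] => x.
  apply: (free_hom_ext freeb (f := H f1 \o phi) (g := H f2 \o phi)) => j /=.
  by have /ffunP/(_ j) := G12; rewrite !ffunE.
have GD : G @: D = D.
  apply/eqP; rewrite eqEcard card_in_imset// leqnn andbT.
  apply/fintype.subsetP => _ /imsetP[f fD ->]; rewrite inE; apply/forallP => i.
  by rewrite ffunE; apply: UD.
pose f0 := [ffun i => theta (b i)].
have : f0 \in G @: D by rewrite GD inE; apply/forallP => i; rewrite ffunE.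
case/imsetP => f _ f0E; exists (H f) => x.
apply: (free_hom_ext freeb (g := H f \o phi)) => i /=.
by have /ffunP/(_ i) := f0E; rewrite !ffunE.
Qed.

End UnitriangularHomomorphisms.

(** * Injectivity of endomorphisms *)

Lemma nonzero_mod_prime (z : int) : z != 0%R ->
  exists2 p, prime p & (z%:~R != 0 :> 'F_p)%R.
Proof.
move=> z0; have [p zp pp] := prime_above `|z|%N; exists p => //.
have kp k : (0 < k < p)%N -> (k%:R != 0 :> 'F_p)%R.
  by move=> /andP[k0 kp]; rewrite -(dvdn_pcharf (pchar_Fp pp)) gtnNdvd.
case: z z0 zp => k z0 zp; first by rewrite -pmulrn kp// lt0n zp andbT.
by rewrite NegzE mulrNz oppr_eq0 -pmulrn kp.
Qed.

Section Detection.

Variables (n : nat) (F : groupType) (b : 'I_n -> F).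
Hypothesis freeb : is_free_basis b.
Variables (K : finFieldType) (s : seq ('I_n * int)).
Local Notation m := (size s).
Hypothesis sred : reduced s.

Local Open Scope ring_scope.

(** The adjacency matrix of the edges labelled [i] in the path
    0 -> 1 -> ... -> m whose edge from j to j+1 carries the letter of the j-th
    syllable. No edge leaves m, so the default value of [nth] is never read. *)
Definition edge_mx (i : 'I_n) : 'M[K]_m.+1 :=
  \matrix_(r, c) ((c == r.+1 :> nat) && (nth i [seq y.1 | y <- s] r == i))%:R.

Lemma edge_mxE (i : 'I_n) (A : 'M[K]_m.+1) (r c : 'I_m.+1) :
  (A *m edge_mx i) r c =
    if c == 0 :> nat then 0
    else A r (inord c.-1) * (nth i [seq y.1 | y <- s] c.-1 == i)%:R.
Proof.
rewrite mxE; case: ifP => [/eqP c0|c0].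
  by rewrite big1// => l _; rewrite mxE c0 mulr0.
have cE : c = c.-1.+1 :> nat by rewrite prednK// lt0n c0.
have cm : (c.-1 < m.+1)%N by rewrite -cE ltnW.
rewrite (bigD1 (inord c.-1))//= big1 ?addr0 => [|l lc].
  by rewrite mxE inordK// -cE eqxx.
rewrite mxE; suff -> : (c == l.+1 :> nat) = false by rewrite mulr0.
apply: contraNF lc => /eqP cl; apply/eqP/val_inj; rewrite /= inordK//.
by rewrite cl.
Qed.

(** Consecutive edges carry different letters, as [s] is reduced. *)
Lemma edge_mx_sqr0 i : edge_mx i *m edge_mx i = 0.
Proof.
apply/matrixP => r c; rewrite edge_mxE [RHS]mxE; case: ifP => // c0.
have cE : c = c.-1.+1 :> nat by rewrite prednK// lt0n c0.
have cm : (c.-1 < m.+1)%N by rewrite -cE ltnW.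
rewrite mxE inordK//.
case: andP => [[/eqP rc /eqP ri]|_]; last by rewrite mul0r.
rewrite mul1r; case: eqP => // ri'.
have /andP[/(sortedP (i, 0)) ss _] := sred.
have rm : (r.+1 < m)%N by rewrite -rc -ltnS -cE.
have := ss _ rm; rewrite -!(nth_map (i, 0) i fst)// ?(ltnW rm)//.
by rewrite ri -rc ri' eqxx.
Qed.

Lemma edge_mx_unit i z : 1 + z *: edge_mx i \in unitmx.
Proof.
have : (1 + z *: edge_mx i) * (1 - z *: edge_mx i) = 1.
  rewrite mulrDl mul1r mulrBr mulr1 -scalerAl -scalerAr [_ * _]edge_mx_sqr0.
  by rewrite !scaler0 subr0 subrK.
by case/mulmx1_unit.
Qed.

Definition edge_hom (theta : F -> {'GL_m.+1[K]}) : Prop :=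
  forall i, GLval (theta (b i)) = 1 + edge_mx i.

Lemma edge_hom_exists :
  exists theta : {multiplicative F -> {'GL_m.+1[K]}}, edge_hom theta.
Proof.
have u i : (1 + edge_mx i) \is a GRing.unit.
  by have := edge_mx_unit i 1; rewrite scale1r.
have [theta thetab _] := freeb (fun i => FinRing.unit _ (u i) : {'GL_m.+1[K]}).
by exists theta => i; rewrite thetab.
Qed.

Variable theta : {multiplicative F -> {'GL_m.+1[K]}}.
Hypothesis thetab : edge_hom theta.

Lemma edge_hom_unitriangular x : unitriangular (theta x).
Proof.
apply: (unitriangular_hom freeb) => i; rewrite /unitriangular thetab.
rewrite addrAC subrr add0r; apply/above_diagP => r c rc; rewrite mxE.
by case: eqP => // cr; rewrite cr addn1 ltnn in rc.
Qed.

Lemma edge_hom_expz i z : GLval (theta (expz (b i) z)) = 1 + z%:~R *: edge_mx i.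
Proof.
have mulE t : 1 + (1 + t)%:~R *: edge_mx i
    = (1 + edge_mx i) * (1 + t%:~R *: edge_mx i).
  rewrite mulrDr mulr1 mulrDl mul1r -scalerAr [_ * _]edge_mx_sqr0 scaler0 addr0.
  by rewrite -addrA intrD scalerDl scale1r.
have U : 1 + edge_mx i \is a GRing.unit.
  by have := edge_mx_unit i 1; rewrite scale1r.
have succE t : GLval (theta (expz (b i) (1 + t)%R))
    = (1 + edge_mx i) * GLval (theta (expz (b i) t)).
  by rewrite expz_succ gmulfM GL_ME thetab.
elim/int_rect: z => [|k IHk|k IHk].
- by rewrite /= hom1 GL_1E mulr0z scale0r addr0.
- by rewrite -[k.+1]/(1 + k)%N PoszD succE IHk mulE.
- apply: (mulrI U); rewrite -succE -mulE -[k.+1]/(1 + k)%N PoszD.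
  by rewrite opprD addrA subrr add0r.
Qed.

(** Row 0 weighs the walks starting at vertex 0. By [edge_mx_sqr0] each
    syllable follows at most one edge, so after [j] syllables the vertex [j] is
    reached only by the walk that moves at each of them, weighted by the
    exponents, and no further vertex is reached. *)
Lemma edge_hom_prefix j : (j <= m)%N ->
  let A := GLval (theta (syllable_prod b (take j s))) in
  (forall c : 'I_m.+1, (j < c)%N -> A 0 c = 0) /\
  A 0 (inord j) = (\prod_(y <- take j s) y.2)%:~R.
Proof.
elim: j => [_|j IHj jm].
  rewrite take0 /syllable_prod !big_nil hom1 GL_1E; split=> [c c0|].
    by rewrite mxE; case: eqP => // c0'; rewrite -c0' in c0.
  by rewrite mxE; case: eqP => // -[]; apply/val_inj; rewrite /= inordK.
have [IH0 IH1] := IHj (ltnW jm); rewrite /=.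
have [i0 _] : 'I_n * int by case: (s) jm.
rewrite (take_nth (i0, 0))//; set y := nth _ _ _.
rewrite /syllable_prod -cats1 !big_cat !big_seq1 gmulfM GL_ME edge_hom_expz.
rewrite -/(syllable_prod b (take j s)).
set A := GLval _ in IH0 IH1 *.
have E c : (A * (1 + y.2%:~R *: edge_mx y.1)) 0 c =
   A 0 c + y.2%:~R * (if c == 0 :> nat then 0
    else A 0 (inord c.-1) * (nth y.1 [seq y.1 | y <- s] c.-1 == y.1)%:R).
  rewrite mulrDr mulr1 -scalerAr mxE [X in _ + X]mxE.
  by rewrite -[A * edge_mx y.1]/(A *m edge_mx y.1) edge_mxE.
split=> [c jc|].
  rewrite E IH0 ?(ltnW jc)// add0r; case: eqP => c0; first by rewrite mulr0.
  have cm : (c.-1 < m.+1)%N := leq_ltn_trans (leq_pred c) (ltn_ord c).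
  by rewrite IH0 ?mul0r ?mulr0// inordK// -ltnS prednK// lt0n; apply/eqP.
rewrite E IH0 ?inordK//= add0r IH1 (nth_map (i0, 0))// eqxx mulr1.
by rewrite -intrM mulrC.
Qed.

Lemma edge_hom_detects :
  ((\prod_(y <- s) y.2)%:~R != 0 :> K) -> s != [::] ->
  theta (syllable_prod b s) <> 1%g.
Proof.
move=> e0 s0 th1; have [_] := edge_hom_prefix (leqnn m).
rewrite take_size th1 GL_1E mxE => e1.
move: e0; rewrite -e1; case: (_ =P inord _) => [|_]; last by rewrite eqxx.
move=> /(congr1 val); rewrite /= inordK// => /esym/size0nil sE.
by rewrite sE in s0.
Qed.

End Detection.

(** The prime is chosen not to divide the determinant, so that homomorphisms
    lift along [phi], nor the exponents of a given word of the kernel, so that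
    this word is detected. *)
Lemma injective_of_det (n : nat) (F : groupType) (b : 'I_n -> F)
    (freeb : is_free_basis b) (mu : {multiplicative F -> magnus2 int n})
    (phi : {multiplicative F -> F}) : is_magnus b mu ->
  (\det (abelianized b mu phi) != 0)%R -> injective phi.
Proof.
move=> mub det0; apply: hom_inj => g phig.
have [s sred sg] := reduced_form freeb g.
have [s0|sN0] := eqVneq s [::]; first by rewrite -sg s0 /syllable_prod big_nil.
have e0 : (\prod_(y <- s) y.2)%R != 0%R.
  rewrite prodf_seq_neq0; have /andP[_ /allP sn] := sred.
  by apply/allP => y ys; rewrite sn.
have [p pp] := nonzero_mod_prime (mulf_neq0 det0 e0).
rewrite intrM mulf_eq0 negb_or => /andP[detp ep].
have [theta thetab] := edge_hom_exists freeb 'F_p sred.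
have [th' th'E] := unitriangular_hom_lift freeb mub detp
  (edge_hom_unitriangular freeb thetab).
case: (edge_hom_detects sred thetab ep sN0).
by rewrite sg th'E phig hom1.
Qed.

(** * Retractions of subgroups *)

Section CocycleGroup.

Variable G : groupType.

(** The semidirect product of the group of functions from G to itself by G. A
    homomorphism from G to it lifting the identity of G is a 1-cocycle: an
    assignment of elements of G to the paths of the Cayley graph of G which is
    multiplicative along concatenation. *)
Definition cocycle_group := ((G -> G) * G)%type.

HB.instance Definition _ := Choice.on cocycle_group.

Implicit Types u v : cocycle_group.

Definition cocycle_one : cocycle_group := (fun=> 1, 1).
Definition cocycle_mul u v : cocycle_group :=
  (fun x => u.1 x * v.1 (x * u.2), u.2 * v.2).
Definition cocycle_inv u : cocycle_group :=
  (fun x => (u.1 (x * u.2^-1))^-1, u.2^-1).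

Fact cocycle_mulA : associative cocycle_mul.
Proof.
move=> u v w; congr (_, _); last exact: mulgA.
by apply/funext => x /=; rewrite !mulgA.
Qed.

Fact cocycle_mul1 : left_id cocycle_one cocycle_mul.
Proof.
move=> [f g]; congr (_, _); last exact: mul1g.
by apply/funext => x /=; rewrite mul1g mulg1.
Qed.

Fact cocycle_1mul : right_id cocycle_one cocycle_mul.
Proof.
move=> [f g]; congr (_, _); last exact: mulg1.
by apply/funext => x /=; rewrite mulg1.
Qed.

Fact cocycle_mulV : left_inverse cocycle_one cocycle_inv cocycle_mul.
Proof.
move=> [f g]; congr (_, _); last exact: mulVg.
by apply/funext => x /=; rewrite mulVg.
Qed.

Fact cocycle_Vmul : right_inverse cocycle_one cocycle_inv cocycle_mul.
Proof.
move=> [f g]; congr (_, _); last exact: mulgV.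
by apply/funext => x /=; rewrite mulgK mulgV.
Qed.

HB.instance Definition _ := isGroup.Build cocycle_group
  cocycle_mulA cocycle_mul1 cocycle_1mul cocycle_mulV cocycle_Vmul.

End CocycleGroup.

Section Retraction.

Variables (n : nat) (F : groupType) (b : 'I_n -> F).
Hypothesis freeb : is_free_basis b.

(** [C v x] is the value on the path labelled [x] starting at [v]; as the group
    is free, the values on the edges can be prescribed. *)
Lemma cocycle_exists (c : F -> 'I_n -> F) :
  exists C : F -> F -> F,
    (forall v x y, C v (x * y) = C v x * C (v * x) y) /\
    (forall v i, C v (b i) = c v i).
Proof.
have [Psi Psib _] := freeb (fun i => (c^~ i, b i) : cocycle_group F).
have Psi2 x : (Psi x).2 = x.
  apply: (free_basis_ind freeb (P := fun x => (Psi x).2 = x)) => [|i].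
    by split=> [|y z yE zE|y yE]; rewrite ?hom1 ?gmulfM ?homV//= ?yE ?zE.
  by rewrite Psib.
exists (fun v x => (Psi x).1 v); split=> [v x y|v i]; last by rewrite Psib.
by rewrite gmulfM /= Psi2.
Qed.

Definition cayley_path (m : nat) (p : nat -> F) : Prop :=
  p 0%N = 1 /\ forall k, (k < m)%N ->
    exists i, p k.+1 = p k * b i \/ p k = p k.+1 * b i.

(** As for [reduced_form], right translations preserving the set of reachable
    elements in both directions form a subgroup. *)
Lemma cayley_path_exists (w : F) : exists m p, cayley_path m p /\ p m = w.
Proof.
pose P u := forall w, (exists m p, cayley_path m p /\ p m = w) <->
                      (exists m p, cayley_path m p /\ p m = w * u).
suff Pw : P w.
  rewrite -[w]mul1g; apply: (iffLR (Pw 1)).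
  by exists 0%N, (fun=> 1); split=> //; split.
have extend u v m p : (exists i, u = v * b i \/ v = u * b i) ->
    cayley_path m p -> p m = v -> exists m p, cayley_path m p /\ p m = u.
  move=> uv [p0 pS] pm.
  exists m.+1, (fun k => if (k <= m)%N then p k else u); rewrite ltnn.
  split=> //; split=> // k; rewrite ltnS => km; rewrite km.
  case: ltnP => [|mk]; first exact: pS.
  have -> : k = m by apply/eqP; rewrite eqn_leq km.
  by rewrite pm.
apply: (free_basis_ind freeb (P := P)) => [|i u].
  split=> [u|x y Px Py u|x Px u]; first by rewrite mulg1.
  - by rewrite mulgA -Py.
  - by rewrite [in X in _ <-> X]Px mulgVK.
split=> -[m [p [pp pm]]]; apply: extend pp pm; exists i; first by left.
by right.
Qed.

Variables (m : nat) (p : nat -> F).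
Hypothesis pathp : cayley_path m p.
Let p0 : p 0%N = 1 := pathp.1.

(** The relation [R] tells which vertices of the path are identified in a
    quotient of the Cayley graph; the image of the path is then a graph whose
    fundamental group is generated by the loops p_i p_j^-1. *)
Definition loop_subgroup (R : rel 'I_m.+1) : set F :=
  [set x | forall P : set F, is_subgroup P ->
     (forall i j : 'I_m.+1, R i j -> P (p i / p j)) -> P x].

Definition same_coset (H : set F) : rel 'I_m.+1 :=
  fun i j => `[< H (p i / p j) >].

Lemma loop_subgroup_subgroup R : is_subgroup (loop_subgroup R).
Proof.
split=> [P [] //|x y xK yK P sgP PR|x xK P sgP PR].
  by have [_ PM _] := sgP; apply: PM; [exact: xK | exact: yK].
by have [_ _ PV] := sgP; apply: PV; exact: xK.
Qed.

Lemma loop_subgroup_gen (R : rel 'I_m.+1) (i j : 'I_m.+1) :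
  R i j -> loop_subgroup R (p i / p j).
Proof. by move=> Rij P sgP PR; apply: PR. Qed.

Variables (H : set F) (sgH : is_subgroup H).
Local Notation K := (loop_subgroup (same_coset H)).

Lemma loop_subgroup_sub : K `<=` H.
Proof. by move=> x Kx; apply: Kx => // i j /asboolP. Qed.

Lemma loop_subgroup_end : H (p m) -> K (p m).
Proof.
move=> Hm; rewrite -[p m]divg1 -p0.
apply: (@loop_subgroup_gen _ ord_max ord0).
by apply/asboolP; rewrite /= p0 divg1.
Qed.

(** The fundamental group of the coset graph of [H] is [H]. Send an edge of this
    graph which is not on the path to 1, and an edge on the path to the loop
    which joins its ends to the base point along the path. The resulting cocycle
    takes its values in [K]. It depends only on the coset of the starting point,
    so it is multiplicative on [H], and it telescopes along the path, so it is
    the identity on [K]. *)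
Lemma retraction_exists : exists r : F -> F,
  [/\ forall x y, H x -> r (x * y) = r x * r y,
      forall x, K (r x) & forall x, K x -> r x = x].
Proof.
have [H1 HM HV] := sgH.
have [K1 KM KV] := loop_subgroup_subgroup (same_coset H).
have HMl h x : H h -> H (h * x) <-> H x.
  by move=> Hh; split=> [/(HM _ _ (HV _ Hh))|/(HM _ _ Hh)//]; rewrite mulKg.
(* A representative among the vertices of the path for each coset that it
   meets. The coset [H] is represented by 1, so that the cocycle restricts to
   the identity on [K] and not to a conjugation. *)
pose t v := if `[< H v >] then 1 else
  if [pick k : 'I_m.+1 | `[< H (v / p k) >]] is Some k then p k else 1.
have tH h v : H h -> t (h * v) = t v.
  move=> Hh; rewrite /t (asbool_equiv_eq (HMl h v Hh)); case: ifP => // _.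
  congr (if _ is Some k then _ else _); apply: eq_pick => k.
  by rewrite -mulgA; apply/asbool_equiv_eq/HMl.
have tP v (k : 'I_m.+1) : H (v / p k) -> K (t v / p k) /\ K (p k / t v).
  move=> vk.
  suff [k' tk' Hk'] : exists2 k' : 'I_m.+1, t v = p k' & H (v / p k').
    have Hkk' : H (p k / p k').
      by rewrite -(divgKA v) -[p k * _]invgF; apply: HM => //; apply: HV.
    have Kkk' : K (p k / p k') by apply: loop_subgroup_gen; apply/asboolP.
    by rewrite tk' -[p k' / _]invgF; split=> //; apply: KV.
  rewrite /t; case: asboolP => Hv; first by exists ord0; rewrite /= p0 ?divg1.
  case: pickP => [k' /asboolP k'H|/(_ k)/asboolP//]; by exists k'.
pose on_path v i := exists2 k : 'I_m.+1, H (v / p k) &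
  exists k' : 'I_m.+1, p k' = p k * b i.
pose c v i := if `[< on_path v i >] then t v * b i / t (v * b i) else 1.
have cH h v i : H h -> c (h * v) i = c v i.
  move=> Hh; rewrite /c -[h * v * b i]mulgA !(tH h)//.
  suff -> : on_path (h * v) i = on_path v i by [].
  apply/propext; rewrite /on_path.
  by split=> -[k vk kk']; exists k => //; move: vk; rewrite -mulgA;
    move/(HMl h _ Hh).
have cK v i : K (c v i).
  rewrite /c; case: asboolP => // -[k vk [k' kk']].
  have [tvk _] := tP _ _ vk.
  have [|_ ktv] := tP (v * b i) k'; first by rewrite kk' invgM mulgA mulgK.
  by have := KM _ _ tvk ktv; rewrite kk' !mulgA mulgVK.
have [C [CM Cb]] := cocycle_exists c.
have C1 v : C v 1 = 1.
  by apply: (mulgI (C v 1)); rewrite -[in RHS](mulg1 1) CM !mulg1.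
have CV v x : C v x^-1 = (C (v * x^-1) x)^-1.
  by apply/esym/mulg1_eq; rewrite -{2}(mulgVK x v) -CM mulgV C1.
have CH x : forall h v, H h -> C (h * v) x = C v x.
  pose P y := forall h v, H h -> C (h * v) y = C v y.
  apply: (free_basis_ind freeb (P := P)).
    split=> [h v _|y z Cy Cz h v Hh|y Cy h v Hh]; first by rewrite !C1.
      by rewrite !CM (Cy h)// -mulgA (Cz h).
    by rewrite !CV -mulgA (Cy h).
  by move=> i h v Hh; rewrite !Cb cH.
have CK x : forall v, K (C v x).
  apply: (free_basis_ind freeb (P := fun x => forall v, K (C v x))).
    split=> [v|y z Cy Cz v|y Cy v]; rewrite ?C1 ?CM ?CV//; first exact: KM.
    exact: KV.
  by move=> i v; rewrite Cb.
have Cp k : (k <= m)%N -> C 1 (p k) = p k / t (p k).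
  elim: k => [_|k IHk km].
    by rewrite p0 C1 /t; case: asboolP => //; rewrite invg1 mulg1.
  have [i pi] := pathp.2 k km.
  have edge (u v : 'I_m.+1) : p v = p u * b i ->
      C (p u) (b i) = t (p u) * b i / t (p v).
    move=> uv; rewrite Cb /c uv; case: asboolP => // -[].
    by exists u; [rewrite mulgV | exists v].
  have kI : (k < m.+1)%N := ltnW km.
  case: pi => pi.
    rewrite pi CM mul1g IHk ?(ltnW km)//.
    rewrite (edge (Ordinal kI) (Ordinal (km : k.+1 < m.+1)%N))//= pi.
    by rewrite !mulgA mulgVK.
  have pE : p k.+1 = p k / b i by rewrite pi mulgK.
  rewrite {1}pE CM mul1g IHk ?(ltnW km)// CV -pE.
  rewrite (edge (Ordinal (km : k.+1 < m.+1)%N) (Ordinal kI))//=.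
  by rewrite !invgM invgK !mulgA mulgVK -pE.
have CHM x y : H x -> C 1 (x * y) = C 1 x * C 1 y.
  by move=> Hx; rewrite CM mul1g -(CH y x 1)// mulg1.
exists (C 1); split=> // x Kx.
suff [] : H x /\ C 1 x = x by [].
apply: (Kx [set y | H y /\ C 1 y = y]).
  split=> [|y z [Hy Cy] [Hz Cz]|y [Hy Cy]]; rewrite ?C1//.
    by split; [exact: HM | rewrite CHM// Cy Cz].
  split; first exact: HV.
  rewrite CV mul1g -[in X in C X y](mulg1 y^-1) (CH _ y^-1) ?Cy//.
  exact: HV.
move=> i j /asboolP Hij; split=> //.
have -> : C 1 (p i / p j) = C 1 (p i) / C 1 (p j).
  by rewrite CM mul1g CV -[p i / p j]mulg1 (CH _ (p i / p j)).
have tij : t (p i) = t (p j) by rewrite -[p i](mulgVK (p j)) tH.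
by rewrite !Cp -1?ltnS// tij invgM invgK !mulgA mulgVK.
Qed.

End Retraction.

(** * Nonsingular words are test elements *)

Lemma finite_repetition (T : finType) (f : nat -> T) :
  exists j k, (j < k)%N /\ f j = f k.
Proof.
apply: contrapT => nf.
have : injective (fun i : 'I_(#|T|.+1) => f i).
  move=> i j fij; apply/val_inj; case: (ltngtP i j) => // ij; case: nf.
    by exists i, j.
  by exists j, i.
by move/leq_card; rewrite card_ord ltnn.
Qed.

Section Iterates.

Variables (G : groupType) (phi : {multiplicative G -> G}).

Lemma iter_homM k : {morph iter k phi : x y / x * y}.
Proof. by elim: k => // k IHk x y; rewrite !iterS IHk gmulfM. Qed.

Lemma iter_image_subgroup k : is_subgroup (range (iter k phi)).
Proof.
pose f : {multiplicative G -> G} := HB.pack (iter k phi)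
  (isMultiplicative.Build G G _ (@iter_homM k)).
have fE x : iter k phi x = f x by [].
split=> [|_ _ [x _ <-] [y _ <-]|_ [x _ <-]].
- by exists 1; rewrite // fE hom1.
- by exists (x * y); rewrite // iter_homM.
- by exists x^-1; rewrite // !fE homV.
Qed.

Lemma iter_inj k : injective phi -> injective (iter k phi).
Proof.
by move=> phiI; elim: k => // k IHk x y; rewrite !iterS => /phiI/IHk.
Qed.

End Iterates.

Section TestElements.

Variables (n : nat) (F : groupType) (b : 'I_n -> F).
Hypothesis freeb : is_free_basis b.
Variable w : F.
Hypothesis ndw : nonsingular b w.

Lemma fixing_injective (phi : {multiplicative F -> F}) :
  phi w = w -> injective phi.
Proof.
move=> phiw; have [mu mub] := magnus_exists freeb int.
exact: (injective_of_det freeb mub (fixing_abelianized_det freeb mub ndw phiw)).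
Qed.

Lemma fixing_idempotent_id (rho : {multiplicative F -> F}) :
  rho w = w -> (forall x, rho (rho x) = rho x) -> forall x, rho x = x.
Proof. by move=> rhow rhoK x; apply: (fixing_injective rhow). Qed.

Variable phi : {multiplicative F -> F}.
Hypothesis phiw : phi w = w.

Variables (m : nat) (p : nat -> F).
Hypothesis (pathp : cayley_path b m p) (pw : p m = w).

(** Conjugated by the k-th iterate of [phi], which is injective, the retraction
    of its image onto the loop subgroup is an idempotent endomorphism of [F]
    fixing [w], hence the identity. *)
Lemma image_loop_subgroup k :
  range (iter k phi) `<=`
    loop_subgroup p (same_coset p (range (iter k phi)) : rel 'I_m.+1).
Proof.
have phiI := fixing_injective phiw.
have sgI := iter_image_subgroup phi k.
have [r [rM rK rid]] := retraction_exists freeb pathp sgI.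
have /choice[rho rhoE] x : exists y, iter k phi y = r (iter k phi x).
  have [y _ <-] := loop_subgroup_sub sgI (rK (iter k phi x)).
  by exists y.
have rhoM : {morph rho : x y / x * y}.
  move=> x y; apply: (iter_inj phiI (k := k)).
  by rewrite iter_homM !rhoE iter_homM rM//; exists x.
pose f : {multiplicative F -> F} :=
  HB.pack rho (isMultiplicative.Build F F rho rhoM).
move=> _ [x _ <-]; rewrite -[X in iter k phi X](@fixing_idempotent_id f).
- by rewrite /= rhoE.
- apply: (iter_inj phiI (k := k)); rewrite /= rhoE.
  have wk : iter k phi w = w by elim: (k) => // l IHl; rewrite iterS IHl phiw.
  rewrite wk rid// -{1}pw; apply: (loop_subgroup_end pathp).
  by rewrite pw; exists w.
- by move=> y; apply: (iter_inj phiI (k := k)); rewrite /= !rhoE (rid _ (rK _)).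
Qed.

End TestElements.

(** The images of the iterates are among the finitely many subgroups carried by
    the path of [w], so two of them coincide. *)
Lemma nonsingular_test (n : nat) (F : groupType) (b : 'I_n -> F)
    (freeb : is_free_basis b) (w : F) :
  nonsingular b w -> test_elements F w.
Proof.
move=> ndw phi phiw; have phi_inj := fixing_injective freeb ndw phiw.
have [m [p [pp pw]]] := cayley_path_exists freeb w.
pose T k : {ffun 'I_m.+1 * 'I_m.+1 -> bool} :=
  [ffun ij => same_coset p (range (iter k phi)) ij.1 ij.2].
have [j [k [jk Tjk]]] := finite_repetition T.
have Rjk : same_coset p (range (iter j phi))
    = same_coset p (range (iter k phi)) :> rel 'I_m.+1.
  apply/funext => i; apply/funext => l.
  by have /ffunP/(_ (i, l)) := Tjk; rewrite !ffunE.
have surj x : exists y, phi y = x.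
  have : range (iter j phi) (iter j phi x) by exists x.
  move/(image_loop_subgroup freeb ndw phiw pp pw); rewrite Rjk.
  move/(loop_subgroup_sub (iter_image_subgroup phi k)) => [y _].
  rewrite -(subnKC jk) addSn -addnS iterD => /(iter_inj phi_inj) <-.
  by exists (iter (k - j.+1) phi y).
have /choice[g gK] := surj.
by exists g => x; [apply: phi_inj; rewrite gK | rewrite gK].
Qed.

(** * Correcting an element to a nonsingular one *)

Section DiagonalCorrection.

Variable K : fieldType.
Local Open Scope ring_scope.

(** By induction on the size: once the complement of the first row and column
    is invertible, the determinant is a nonconstant affine function of the
    first diagonal entry, so it cannot vanish at both 0 and 1. *)
Lemma diagonal_correction n (B : 'M[K]_n) :
  exists e : 'I_n -> bool, B + diag_mx (\row_i (e i)%:R) \in unitmx.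
Proof.
elim: n B => [|n IHn] B.
  by exists (fun=> true); rewrite unitmxE det_mx00 unitr1.
have [e ue] := IHn (row' 0 (col' 0 B)).
pose E (t : bool) i := if unlift 0 i is Some k then e k else t.
pose M t := B + diag_mx (\row_i (E t i)%:R).
have Mrow t i j : M t (lift 0 i) j = M false (lift 0 i) j.
  by rewrite !mxE /E !liftK.
have cofM t j : cofactor (M t) 0 j = cofactor (M false) 0 j.
  rewrite /cofactor; congr (_ * \det _); apply/matrixP => i l.
  by rewrite ![row' _ _ _ _]mxE ![col' _ _ _ _]mxE Mrow.
have cof0 : cofactor (M false) 0 0 != 0.
  move: ue; rewrite unitmxE unitfE /cofactor /= addn0 expr0 mul1r.
  congr (\det _ != 0); apply/matrixP => i j; rewrite !mxE /E liftK.
  by rewrite (inj_eq lift_inj).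
have detM : \det (M true) = \det (M false) + cofactor (M false) 0 0.
  rewrite (expand_det_row _ 0) [in RHS](expand_det_row _ 0).
  rewrite !big_ord_recl !cofM [RHS]addrAC; congr (_ + _).
    rewrite !mxE /E !unlift_none eqxx !mulr1n addr0 mulrDl mul1r.
    by [].
  apply: eq_bigr => i _; rewrite cofM; congr (_ * _).
  by rewrite !mxE.
have [M0|M0] := eqVneq (\det (M false)) 0.
  by exists (E true); rewrite -/(M true) unitmxE unitfE detM M0 add0r.
by exists (E false); rewrite -/(M false) unitmxE unitfE.
Qed.

End DiagonalCorrection.

Lemma word_length_le (G : groupType) (X : set G) (s : seq G) :
  (forall x, x \in s -> (X `|` [set y^-1 | y in X]) x) ->
  (word_length X (\prod_(x <- s) x)%g <= size s)%N.
Proof.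
move=> sX; rewrite /word_length; case: xgetP => [k _ [_ kmin]|//].
by apply: kmin; exists s.
Qed.

Section Correction.

Variables (n : nat) (F : groupType) (b : 'I_n -> F).
Hypothesis freeb : is_free_basis b.
Variables (X : set F) (finX : finite_set X) (genX : generates X).
Variable mu : {multiplicative F -> magnus2 'F_2 n}.
Hypothesis mub : is_magnus b mu.

(** A generating set spans the abelianization modulo 2. *)
Lemma basis_in_generators : exists x : 'I_n -> F,
  (forall i, X (x i)) /\ (\matrix_i (mu (x i)).1)%R \in unitmx.
Proof.
have /finite_seqP[xs XE] := finX.
pose A : 'M['F_2]_(size xs, n) := (\matrix_i (mu (nth 1%g xs i)).1)%R.
have lettersA x : X x -> ((mu x).1 <= A)%MS.
  rewrite XE /= => xxs; have xi : (index x xs < size xs)%N by rewrite index_mem.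
  have := row_sub (Ordinal xi) A; rewrite rowK /= nth_index//.
have Afull : row_full A.
  rewrite -sub1mx; apply/row_subP => i; rewrite rowE mulmx1.
  have [_ [s [_ sX bE]]] := genX (b i).
  have -> : delta_mx 0%R i = (mu (b i)).1 by rewrite mub.
  rewrite {}bE; elim: s sX => [|x s IHs] sX.
    by rewrite big_nil hom1 sub0mx.
  rewrite big_cons magnusM1 addmx_sub//; last first.
    by apply: IHs => y ys; apply: sX; rewrite inE ys orbT.
  case: (sX x (mem_head _ _)) => [/lettersA //|[y Xy <-]].
  by rewrite magnusV1 eqmx_opp lettersA.
exists (fun i => nth 1 xs (fullrankfun Afull i)); split=> [i|].
  by rewrite XE /= mem_nth.
rewrite -row_full_unit; have := fullrowsub_full Afull.
by congr (row_full _); apply/matrixP => i j; rewrite !mxE.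
Qed.

Lemma F2_cases (c : 'F_2) : c = 0%R \/ c = 1%R.
Proof. by case: c => [[|[|//]] c2]; [left|right]; apply/val_inj. Qed.

(** With coefficients modulo 2 only the square of the linear part survives, and
    an element without linear part is central modulo degree 3. *)
Lemma magnus_square x : mu (x * x) = (0, (mu x).1^T *m (mu x).1)%R.
Proof.
have pchar2 : (2 \in [pchar 'F_2])%R by exact: pchar_Fp.
rewrite gmulfM; case: (mu x) => a M; congr (_, _) => /=.
  by apply/matrixP => i j; rewrite !mxE (addrr_pchar2 pchar2).
suff -> : (M + M = 0)%R by rewrite add0r.
by apply/matrixP => i j; rewrite !mxE (addrr_pchar2 pchar2).
Qed.

(** The parity [c] of the exponent is imposed by the linear part to be
    cancelled. In each parity there are two words of length at most two that
    differ by x^2: 1 and x^2, or x^-1 and x. The bit [e] chooses one. *)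
Definition correction_word (c e : bool) (x : F) : seq F :=
  if c then if e then [:: x] else [:: x^-1] else if e then [:: x; x] else [::].

Definition parity_word (c : bool) (x : F) : F := if c then x^-1 else 1.

Lemma correction_wordE c e x : \prod_(y <- correction_word c e x) y =
  parity_word c x * (if e then x * x else 1).
Proof.
by case: c; case: e; rewrite /= ?big_cons ?big_nil ?mulg1 ?mul1g ?mulKg.
Qed.

(** Let [P] be the matrix of linear parts of a basis chosen in [X], and [M] the
    quadratic part after cancellation of the linear part. The bits [e] add
    P^T D P to [M], where [D] is their diagonal matrix, so [diagonal_correction]
    is applied to [M] expressed in that basis. *)
Lemma nonsingular_nearby (g : F) :
  exists s : seq F, [/\ (size s <= 2 * n)%N,
    forall x, x \in s -> (X `|` [set y^-1 | y in X]) x &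
    nonsingular b (g * \prod_(x <- s) x)].
Proof.
have [x [xX uP]] := basis_in_generators.
set P := (\matrix_i _)%R in uP.
pose c : 'rV['F_2]_n := ((mu g).1 *m invmx P)%R.
have cP : (c *m P)%R = (mu g).1 by rewrite mulmxKV.
pose par i := parity_word (c 0%R i != 0%R) (x i).
pose g0 := g * \prod_(i <- enum 'I_n) par i.
have g0_1 : (mu g0).1 = 0%R.
  rewrite magnusM1 -cP mulmx_sum_row.
  have -> : (mu (\prod_(i <- enum 'I_n) par i)).1
      = (\sum_(i <- enum 'I_n) (mu (par i)).1)%R.
    elim: (enum _) => [|i r IHr]; first by rewrite !big_nil hom1.
    by rewrite !big_cons magnusM1 IHr.
  rewrite big_enum -big_split big1// => i _ /=; rewrite rowK /par.
  have [->|->] := F2_cases (c 0%R i); first by rewrite eqxx scale0r hom1 addr0.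
  by rewrite oner_eq0 /= scale1r magnusV1 subrr.
have [e ue] := diagonal_correction ((invmx P)^T *m (mu g0).2 *m invmx P)%R.
pose word i := correction_word (c 0%R i != 0%R) (e i) (x i).
exists (flatten [seq word i | i <- enum 'I_n]).
split.
- rewrite size_flatten /shape -map_comp sumnE big_map big_enum /=.
  rewrite mulnC -[X in (_ <= X * _)%N]card_ord -sum_nat_const leq_sum// => i _.
  by rewrite /word /correction_word; case: ifP; case: (e i).
- move=> y /flattenP[_ /mapP[i _ ->]].
  rewrite /word /correction_word.
  case: ifP => _; case: (e i); rewrite ?inE ?orbb.
  + by move/eqP ->; left.
  + by move/eqP ->; right; exists (x i).
  + by move/eqP ->; left.
  + by [].
exists mu => //.
rewrite big_flatten big_map /=.
pose Q i := ((e i)%:R *: ((mu (x i)).1^T *m (mu (x i)).1))%R.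
have muE r : mu (\prod_(i <- r) \prod_(y <- word i) y)
    = mu (\prod_(i <- r) par i) * ((0, \sum_(i <- r) Q i)%R : magnus2 _ _).
  elim: r => [|i r IHr]; first by rewrite !big_nil hom1 mul1g.
  rewrite !big_cons !gmulfM IHr correction_wordE gmulfM -/(par i).
  have -> : mu (if e i then x i * x i else 1) = (0, Q i)%R.
    by rewrite /Q; case: (e i); rewrite ?magnus_square ?hom1 ?scale1r ?scale0r.
  case: (mu (par i)) (mu (\prod_(j <- r) _)) => [a M] [a' M'].
  congr (_, _) => /=; first by rewrite !addr0.
  by rewrite !mulmx0 !addr0 !addrA [RHS](ACl (1*4*2*5*3))%R.
rewrite gmulfM muE mulgA -gmulfM -/g0; case: (mu g0) g0_1 ue => a M /= -> ue.
split; first by rewrite /= addr0.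
rewrite /= trmx0 mul0mx addr0.
have -> : (\sum_(i <- enum 'I_n) Q i = P^T *m diag_mx (\row_i (e i)%:R) *m P)%R.
  rewrite big_enum; apply/matrixP => i j; rewrite summxE !mxE /=.
  apply: eq_bigr => l _; rewrite mul_mx_diag !mxE big_ord1 !mxE.
  by rewrite mulrCA mulrA.
have -> : (M + P^T *m diag_mx (\row_i (e i)%:R) *m P = P^T *m
    ((invmx P)^T *m M *m invmx P + diag_mx (\row_i (e i)%:R)) *m P)%R.
  rewrite mulmxDr mulmxDl !mulmxA -trmx_mul mulVmx// trmx1 mul1mx.
  by rewrite mulmxKV.
by rewrite !unitmx_mul unitmx_tr uP ue.
Qed.

End Correction.

Theorem theorem1 (R : realType) (n : nat) (F : groupType)
    (hn : (2 <= n)%N) (hF : free_of_rank F n)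
    (X : set F) (finX : finite_set X) (genX : generates X) :
  is_net X (3 * n%:R - 2 : R)%R (test_elements F).
Proof.
have [b freeb] := hF; have [mu mub] := magnus_exists freeb 'F_2.
have n2 : (2 * n%:R <= 3 * n%:R - 2 :> R)%R.
  rewrite lerBrDr -!natrM -natrD ler_nat -[2]/(2 * 1)%N.
  by rewrite (mulSn 2) addnC leq_add2r.
split=> [|g]; first by apply: le_trans n2; rewrite -natrM.
have [s [s_le sX sns]] := nonsingular_nearby finX genX mub g.
apply: le_trans (ereal_inf_lbound _) _.
  by exists (g * \prod_(x <- s) x) => //; exact: (nonsingular_test freeb sns).
rewrite lee_fin (le_trans _ n2)// -natrM ler_nat /word_dist mulKg.
exact: leq_trans (word_length_le sX) s_le.
Qed.
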